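(* Let $N\ge 2$ be an integer. For every $0<\epsilon<1$, with $$\alpha_{\epsilon}=\frac{1}{N}(1-\epsilon)\quad\text{and}\quad m_{\epsilon}=\frac{N(N-1)\epsilon^2}{1+(N-1)\epsilon^2},$$ the following inclusion of cones in $\mathbb{R}^N$ holds: $$\Gamma^{+}_{2}(\alpha_{\epsilon})\subset \mathcal{P}_{m_{\epsilon}}.$$
   Context: For $V=(\mu_1,\dots,\mu_N)\in\mathbb{R}^N$ let $\sigma_j(V)=\sum_{1\le i_1<\cdots<i_j\le N}\mu_{i_1}\cdots\mu_{i_j}$. The Gårding cone is $\Gamma_k^+=\{V\in\mathbb{R}^N:\sigma_j(V)>0\text{ for all }j=1,\dots,k\}$. For $\alpha\ge 0$ put $V_\alpha=V-\alpha\overline{\mu}\,(1,\dots,1)$ with $\overline{\mu}=\sum_{i=1}^N\mu_i$, and define $\Gamma_k^+(\alpha)=\{V\in\mathbb{R}^N: V_\alpha\in\Gamma_k^+\}$. For a real number $0<m<N$, $\mathcal{P}_m$ is the set of $V=(\mu_1,\dots,\mu_N)\in\mathbb{R}^N$ such that $\mu_{i_1}+\cdots+\mu_{i_{\lfloor m\rfloor}}+(m-\lfloor m\rfloor)\mu_{i_{\lfloor m\rfloor+1}}>0$ for all pairwise distinct indices $i_1,\dots,i_{\lfloor m\rfloor+1}\in\{1,\dots,N\}$ (equivalently, the inequality holds with the entries of $V$ arranged in nondecreasing order and the first $\lfloor m\rfloor+1$ of them used in that order). Here $\lfloor c\rfloor$ is the largest integer not exceeding $c$, and an empty sum is $0$.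 *)

(* Defs.v *)
From mathcomp Require Import all_boot all_order all_algebra.
From mathcomp Require Import classical_sets reals.

Set Implicit Arguments.
Unset Strict Implicit.
Unset Printing Implicit Defensive.

Import Order.TTheory GRing.Theory Num.Theory.
Local Open Scope classical_set_scope.
Local Open Scope ring_scope.

(* Index tuples i_1 < ... < i_j are encoded as j-element subsets of 'I_N. *)
Definition sigma (R : realType) (N : nat) (j : nat) (V : 'rV[R]_N) : R :=
  \sum_(S : {set 'I_N} | #|S| == j) \prod_(i in S) V 0 i.

Definition garding_cone (R : realType) (N : nat) (k : nat) : set 'rV[R]_N :=
  [set V | forall j : nat, (1 <= j <= k)%N -> 0 < sigma j V].

(* \overline{mu} is the sum of the entries, not their mean. *)
Definition mubar (R : realType) (N : nat) (V : 'rV[R]_N) : R :=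
  \sum_(i < N) V 0 i.

Definition shift (R : realType) (N : nat) (alpha : R) (V : 'rV[R]_N) :
    'rV[R]_N :=
  V - (alpha * mubar V) *: const_mx 1.

Definition garding_cone_shift (R : realType) (N : nat) (k : nat) (alpha : R) :
    set 'rV[R]_N :=
  [set V | @garding_cone R N k (shift alpha V)].

(* Meant for 0 < m < N: for m >= N no injective [i] exists, so the condition
   would be vacuous.  For m >= 0, [Num.truncn m] is the floor of m as a nat. *)
Definition Pcone (R : realType) (N : nat) (m : R) : set 'rV[R]_N :=
  [set V | forall i : 'I_(Num.truncn m).+1 -> 'I_N, injective i ->
     0 < \sum_(l < Num.truncn m) V 0 (i (widen_ord (leqnSn _) l))
         + (m - (Num.truncn m)%:R) * V 0 (i ord_max)].

(* Main.v *)
Require Import Defs.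
From mathcomp Require Import all_boot all_order all_algebra.
From mathcomp Require Import classical_sets reals.
From mathcomp Require Import ring lra.

Import Order.TTheory GRing.Theory Num.Theory.
Local Open Scope classical_set_scope.
Local Open Scope ring_scope.

(** Write s for the sum of the entries of V and W for its shift.  The identity
    s(W)^2 = |W|^2 + 2 sigma_2(W) turns sigma_2(W) > 0 into |W|^2 < s(W)^2:
    the cone Gamma_2^+ is a round cone about the diagonal.  Since W differs
    from V by a multiple of (1, ..., 1), V lies in a round cone as well, and
    expanding |W|^2 ([shift_round_cone]) with alpha = (1 - eps) / N shows that
    it is N |V|^2 < (1 + (N - 1) eps^2) s^2.  As m_eps is the number m with
    N / (N - m) = 1 + (N - 1) eps^2, this reads (N - m_eps) |V|^2 < s^2.

    A defining inequality of P_m asks that a weighted sum c.V be positive,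
    where the weights c_i lie in [0, 1] and have total m.  The complementary
    weights 1 - c_i also lie in [0, 1], so |1 - c|^2 <= N - m, and by
    Cauchy-Schwarz s - c.V = (1 - c).V <= sqrt (N - m) |V| < s, that is,
    c.V > 0; see [weighted_sum_gt0]. *)

(** Off the diagonal, the double sum groups the pairs (x, y) by the set
    {x, y}; each two-element set arises from exactly two pairs. *)
Lemma sqr_sum_sym2 (R : comNzRingType) (I : finType) (F : I -> R) :
  (\sum_i F i) ^+ 2 =
  \sum_i F i ^+ 2 + (\sum_(S : {set I} | #|S| == 2%N) \prod_(i in S) F i) *+ 2.
Proof.
rewrite expr2 mulr_suml.
under eq_bigr => i _ do rewrite mulr_sumr (bigD1 i) //= -expr2.
rewrite big_split /=; congr (_ + _).
rewrite (pair_big_dep xpredT (fun i j => j != i) (fun i j => F i * F j)) /=.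
rewrite (partition_big (fun p : I * I => [set p.1; p.2]%SET)
   (fun S : {set I} => #|S| == 2%N)) /=; last first.
  by move=> [x y] /= yx; rewrite cards2 (eq_sym x) yx.
rewrite -sumrMnl; apply: eq_bigr => S /cards2P [x [y [xy ->]]].
rewrite (bigD1 (x, y)) /=; last by rewrite eq_sym xy eqxx.
rewrite (bigD1 (y, x)) /=; last first.
  by rewrite xy finset.setUC eqxx xpair_eqE (negPf xy) andbF.
rewrite big1 ?addr0; last first.
  move=> [u v] /= /andP[/andP[/andP[vu /eqP/setP E] n1] n2].
  have := E u; have := E v; rewrite !inE !eqxx orbT /=.
  move=> /esym/orP[]/eqP ev /esym/orP[]/eqP eu; move: vu n1 n2;
    by rewrite ev eu ?eqxx.
by rewrite big_setU1 ?inE //= big_set1 (mulrC (F y)) mulr2n.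
Qed.

Lemma sigma1E (R : realType) (N : nat) (V : 'rV[R]_N) : sigma 1 V = mubar V.
Proof.
rewrite /sigma /mubar.
rewrite (eq_bigl (fun S => S \in [set [set i]%SET | i in 'I_N]%SET)).
  rewrite big_imset /=; last by move=> i j _ _; apply: set1_inj.
  by apply: eq_bigr => i _; rewrite big_set1.
move=> S; apply/cards1P/imsetP => [[i ->]|[i _ ->]]; by exists i.
Qed.

(** This is Cauchy-Schwarz for V and 1 - c, done without square roots: the
    squared norm of d V - s (1 - c) is nonnegative, where d = #|I| - m bounds
    |1 - c|^2 because 0 <= 1 - c_i <= 1. *)
Lemma weighted_sum_gt0 (R : realFieldType) (I : finType) (V c : I -> R) (m : R) :
  (forall i, 0 <= c i <= 1) -> \sum_i c i = m -> m < #|I|%:R ->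
  0 < \sum_i V i -> (#|I|%:R - m) * (\sum_i V i ^+ 2) < (\sum_i V i) ^+ 2 ->
  0 < \sum_i c i * V i.
Proof.
move=> c01 cm mN; set s := \sum_i V i; set q := \sum_i V i ^+ 2 => s0 hq.
set d := #|I|%:R - m; have d0 : 0 < d by rewrite subr_gt0.
have hc : \sum_i (1 - c i) ^+ 2 <= d.
  have -> : d = \sum_i (1 - c i).
    by rewrite sumrB cm sumr_const.
  by apply: ler_sum => i _; have := c01 i; nra.
have : 0 <= \sum_i (d * V i - s * (1 - c i)) ^+ 2.
  by apply: sumr_ge0 => i _; apply: sqr_ge0.
have -> : \sum_i (d * V i - s * (1 - c i)) ^+ 2 =
    d ^+ 2 * q - 2 * d * s * (s - \sum_i c i * V i)
      + s ^+ 2 * \sum_i (1 - c i) ^+ 2.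
  have -> : s - \sum_i c i * V i = \sum_i (1 - c i) * V i.
    by rewrite -sumrB; apply: eq_bigr => i _; ring.
  (* [s] is a sum too: abstracting it keeps the next rewrite away from it. *)
  rewrite /q; move: (s) => t; rewrite !mulr_sumr -sumrB -big_split /=.
  by apply: eq_bigr => i _; ring.
set x := \sum_i c i * V i => h.
have h1 : s ^+ 2 * \sum_i (1 - c i) ^+ 2 <= s ^+ 2 * d.
  by apply: ler_wpM2l => //; apply: sqr_ge0.
have h2 : d * (d * q) < d * s ^+ 2 by rewrite ltr_pM2l.
have : 0 < (d * s) * x by lra.
by rewrite pmulr_rgt0 // mulr_gt0.
Qed.

(** Moves weights on a selection of indices to weights on all of them.
    Injectivity of f keeps them at most 1, since no two can accumulate at the
    same index. *)
Lemma pushforward_weights (R : realFieldType) (J I : finType) (f : J -> I)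
    (w : J -> R) : injective f -> (forall l, 0 <= w l <= 1) ->
  exists2 c : I -> R, forall i, 0 <= c i <= 1 &
    forall g : I -> R, \sum_i c i * g i = \sum_l w l * g (f l).
Proof.
move=> finj w01; exists (fun i => \sum_(l | f l == i) w l) => [i|g].
  have [l /eqP <-|nl] := pickP (fun l => f l == i).
    by rewrite (big_pred1 l) // => k; rewrite /= (inj_eq finj).
  by rewrite big_pred0 // lexx ler01.
rewrite [RHS](partition_big f xpredT) //=; apply: eq_bigr => i _.
by rewrite mulr_suml; apply: eq_bigr => l /eqP ->.
Qed.

(** The conditions sigma_1(W) > 0 and sigma_2(W) > 0 for W = shift a V, in the
    form s(W) > 0 and |W|^2 < s(W)^2, with s(W) and |W|^2 expanded in V. *)
Lemma shift_round_cone (R : realType) (N : nat) (a : R) (V : 'rV[R]_N) :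
  garding_cone_shift 2 a V ->
  0 < (1 - N%:R * a) * mubar V /\
  \sum_i V 0 i ^+ 2 - 2 * a * mubar V ^+ 2 + N%:R * a ^+ 2 * mubar V ^+ 2
    < ((1 - N%:R * a) * mubar V) ^+ 2.
Proof.
move=> hV; have := hV 1%N isT; have := hV 2%N isT; rewrite sigma1E.
set s := mubar V.
have WE i : shift a V 0 i = V 0 i - a * s by rewrite !mxE mulr1.
have sW : mubar (shift a V) = (1 - N%:R * a) * s.
  rewrite /mubar (eq_bigr _ (fun i _ => WE i)) sumrB sumr_const card_ord.
  by rewrite -/(mubar V) -/s -mulr_natl; ring.
have qW : \sum_i shift a V 0 i ^+ 2 =
    \sum_i V 0 i ^+ 2 - 2 * a * s ^+ 2 + N%:R * a ^+ 2 * s ^+ 2.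
  have -> : 2 * a * s ^+ 2 = \sum_i (2 * a * s) * V 0 i.
    by rewrite -mulr_sumr -/(mubar V) -/s; ring.
  have -> : N%:R * a ^+ 2 * s ^+ 2 = \sum_(i < N) (a * s) ^+ 2.
    by rewrite sumr_const card_ord -mulr_natl; ring.
  rewrite -sumrB -big_split /=; apply: eq_bigr => i _; rewrite WE; ring.
have := sqr_sum_sym2 R 'I_N (fun i => shift a V 0 i).
rewrite -/(mubar _) -/(sigma 2 _) sW qW => -> s2 s1; split => //.
by rewrite ltrDl pmulrn_lgt0.
Qed.

(** The weights are 1 on the first floor(m) chosen indices and the fractional
    part of m on the last one, so that they add up to m. *)
Lemma round_cone_Pcone (R : realType) (N : nat) (m : R) (V : 'rV[R]_N) :
  0 <= m < N%:R -> 0 < mubar V ->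
  (N%:R - m) * (\sum_i V 0 i ^+ 2) < mubar V ^+ 2 -> Pcone m V.
Proof.
move=> /andP[m0 mN] s0 hq f finj.
have /andP[tm mt] := truncn_itv m0; rewrite -natr1 in mt.
set n := Num.truncn m in f finj tm mt *.
pose w (l : 'I_n.+1) : R := if (l < n)%N then 1 else m - n%:R.
have w01 l : 0 <= w l <= 1 by rewrite /w; case: ifP => _; lra.
have wE (g : 'I_N -> R) : \sum_l w l * g (f l) =
    \sum_(l < n) g (f (widen_ord (leqnSn n) l)) + (m - n%:R) * g (f ord_max).
  rewrite big_ord_recr /= {2}/w ltnn; congr (_ + _).
  by apply: eq_bigr => l _; rewrite /w /= ltn_ord mul1r.
have [c c01 cE] := pushforward_weights R _ _ f w finj w01.
rewrite -(wE (fun i => V 0 i)) -cE.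
apply: (weighted_sum_gt0 R _ _ _ m); rewrite ?card_ord //.
have := etrans (cE (fun=> 1)) (wE (fun=> 1)); rewrite sumr_const card_ord.
by under eq_bigr => i _ do rewrite mulr1; move=> ->; ring.
Qed.

Theorem corollary1p2 (R : realType) (N : nat) (hN : (2 <= N)%N)
    (eps : R) (heps : 0 < eps < 1) :
  let alpha_eps : R := N%:R^-1 * (1 - eps) in
  let m_eps : R :=
    N%:R * (N%:R - 1) * eps ^+ 2 / (1 + (N%:R - 1) * eps ^+ 2) in
  @garding_cone_shift R N 2 alpha_eps `<=` @Pcone R N m_eps.
Proof.
move=> a m V /shift_round_cone.
have /andP[e0 e1] := heps.
have n2 : 2 <= N%:R :> R by rewrite ler_nat.
have n0 : 0 < N%:R :> R by lra.
have -> : 1 - N%:R * a = eps by rewrite /a; field; lra.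
rewrite pmulr_rgt0 // => -[s0 hq].
set D := 1 + (N%:R - 1) * eps ^+ 2.
have D0 : 0 < D.
  by rewrite /D ltr_pwDl // mulr_ge0 ?sqr_ge0 //; lra.
have NmE : N%:R - m = N%:R / D.
  by move: D0; rewrite /m /D => D0; field; lra.
apply: round_cone_Pcone => //.
  rewrite -subr_gt0 NmE divr_gt0 // andbT /m -/D.
  by rewrite divr_ge0 ?(ltW D0) // !mulr_ge0 ?sqr_ge0 //; lra.
rewrite NmE mulrAC ltr_pdivrMr // mulrC -ltr_pdivlMr //.
have -> : mubar V ^+ 2 * D / N%:R = (eps * mubar V) ^+ 2
    + 2 * a * mubar V ^+ 2 - N%:R * a ^+ 2 * mubar V ^+ 2.
  by rewrite /a /D; field; lra.
lra.
Qed.
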